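(* Let $L/K$ be a finite Galois extension of local or global fields (of any characteristic) with Galois group $G$, let $N$ be a $G$-stable regular subgroup of $\mathrm{Perm}(G)$, and let $g\in G$. Then an ambiguous ideal $\mathfrak B$ of $L$ is free over its associated order in $L[N]^G$ if and only if it is free over its associated order in $L[N_g]^G$, where $N_g=\rho(g)N\rho(g)^{-1}$.
   Context: $\mathrm{Perm}(G)$ is the group of permutations of the set $G$; $\lambda(g)[h]=gh$, $\rho(g)[h]=hg^{-1}$. A subgroup $N\le\mathrm{Perm}(G)$ is regular if it acts simply transitively on $G$ and $G$-stable if normalized by $\lambda(G)$; $N_g$ is again $G$-stable regular. $G$ acts on $L[N]$ by $g\ast\sum c_\eta\eta=\sum g(c_\eta)\lambda(g)\eta\lambda(g)^{-1}$, and the fixed ring $L[N]^G$ is a $K$-Hopf algebra acting on $L$ via $\left(\sum_\eta c_\eta\eta\right)\cdot x=\sum_\eta c_\eta\,\eta^{-1}[e_G](x)$ (a Hopf-Galois structure on $L/K$). An ambiguous ideal of $L$ is a fractional ideal of $L$ invariant under $G$. For a Hopf algebra $H$ acting on $L$, the associated order of $\mathfrak B$ in $H$ is $\mathfrak A_H(\mathfrak B)=\{h\in H : h\cdot x\in\mathfrak B \text{ for all } x\in\mathfrak B\}$. *)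

(* Defs.v *)
From HB Require Import structures.
From mathcomp Require Import all_boot all_order all_fingroup all_algebra all_field.

Set Implicit Arguments.
Unset Strict Implicit.
Unset Printing Implicit Defensive.

Import Order.TTheory GRing.Theory Num.Theory.

Local Open Scope ring_scope.

Definition finite_over (k F : fieldType) (iota : k -> F) : Prop :=
  exists (n : nat) (b : 'I_n -> F), forall x : F,
    exists c : 'I_n -> k, x = \sum_(i < n) iota (c i) * b i.

Definition number_field_integers (F : fieldType) (O : F -> Prop) : Prop :=
  exists iota : {rmorphism rat -> F}, finite_over iota /\
    forall x, O x <-> integralOver (intr : int -> F) x.

(* A global function field has no canonical ring of integers.  The rings
   admitted are the integral closures of Fq[t] in F, for every Fq(t) inside F
   over which F is finite (t being the image of 'X under iota). *)
Definition function_field_integers (F : fieldType) (O : F -> Prop) : Prop :=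
  exists (Fq : finFieldType) (iota : {rmorphism {fraction {poly Fq}} -> F}),
    finite_over iota /\
    forall x, O x <-> integralOver (fun q : {poly Fq} => iota (tofrac q)) x.

(* Only the values of v at nonzero elements are meaningful: v 0 is a junk
   value, and val_ge v m x says v(x) >= m under the convention v(0) = +oo. *)
Definition val_ge (F : fieldType) (v : F -> int) (m : int) (x : F) : Prop :=
  x = 0 \/ m <= v x.

Definition discrete_valuation (F : fieldType) (v : F -> int) : Prop :=
  [/\ forall x y, x != 0 -> y != 0 -> v (x * y) = v x + v y,
      forall m x y, val_ge v m x -> val_ge v m y -> val_ge v m (x + y)
    & exists2 pi, pi != 0 & v pi = 1].

Definition val_complete (F : fieldType) (v : F -> int) : Prop :=
  forall u : nat -> F,
    (forall m, exists n0 : nat, forall i j : nat,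
       (n0 <= i)%N -> (n0 <= j)%N -> val_ge v m (u i - u j)) ->
    exists l, forall m, exists n0 : nat, forall i : nat,
       (n0 <= i)%N -> val_ge v m (u i - l).

Definition finite_residue_field (F : fieldType) (v : F -> int) : Prop :=
  exists s : seq F, forall x, val_ge v 0 x ->
    exists2 y, y \in s & val_ge v 1 (x - y).

Definition local_field_integers (F : fieldType) (O : F -> Prop) : Prop :=
  exists v : F -> int,
    [/\ discrete_valuation v, val_complete v, finite_residue_field v
      & forall x, O x <-> val_ge v 0 x].

(* F is a (nonarchimedean) local or global field, with ring of integers O. *)
Definition local_or_global_integers (F : fieldType) (O : F -> Prop) : Prop :=
  [\/ number_field_integers O, function_field_integers O
    | local_field_integers O].

Definition integral_closure (K : fieldType) (L : fieldExtType K)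
    (OK : K -> Prop) (x : L) : Prop :=
  exists p : {poly K}, [/\ p \is monic, forall i, OK p`_i
    & root (map_poly (in_alg L) p) x].

Definition fractional_ideal (F : fieldType) (O B : F -> Prop) : Prop :=
  [/\ forall x y, B x -> B y -> B (x - y),
      forall a x, O a -> B x -> B (a * x),
      exists2 x, B x & x != 0
    & exists d, [/\ O d, d != 0 & forall x, B x -> O (d * x)]].

(* The A-module B, with scalars acting by act, has a basis S.  Only the
   additive structure of A and its action on B enter the definition. *)
Definition free_over (R M : zmodType) (act : R -> M -> M)
    (A : R -> Prop) (B : M -> Prop) : Prop :=
  exists S : M -> Prop,
    [/\ forall y, S y -> B y,
        forall x, B x -> exists (s : seq M) (a : M -> R),
          [/\ forall y, y \in s -> S y, forall y, A (a y)
            & x = \sum_(y <- s) act (a y) y]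
      & forall (s : seq M) (a : M -> R), uniq s ->
          (forall y, y \in s -> S y) -> (forall y, A (a y)) ->
          \sum_(y <- s) act (a y) y = 0 -> forall y, y \in s -> a y = 0].

Section HopfGalois.

Variables (K : fieldType) (L : splittingFieldType K).

Notation G := (gal_of {:L}).

(* G is the whole type of K-automorphisms of L. *)
Lemma gal_of_fullE : 'Gal({:L} / 1%AS)%g = [set: G].
Proof.
apply/setP=> x; rewrite [RHS]inE gal_kHom ?sub1v //.
by apply/kAHomP=> y /vlineP[c ->]; rewrite linearZ /= rmorph1.
Qed.

(* Products in gal_of and in {perm _} are read from left to right:
   (x * y) a = y (x a).  Products of the mathematical text are compositions,
   so the automorphism "gh" is (h * g)%g, and "s t s^-1" is (t ^ s)%g. *)
Definition lam (g : G) : {perm G} := perm (@mulIg _ g).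

Definition rho (g : G) : {perm G} := perm (@mulgI _ g^-1%g).

Lemma lamE (g h : G) (x : L) : lam g h x = g (h x).
Proof. by rewrite permE galM ?memvf. Qed.

Lemma rhoE (g h : G) (x : L) : rho g h x = h (g^-1%g x).
Proof. by rewrite permE galM ?memvf. Qed.

Definition regular_on (N : {set {perm G}}) : Prop :=
  forall x y : G, exists! eta, eta \in N /\ eta x = y.

Definition G_stable (N : {set {perm G}}) : Prop :=
  [set lam g | g : G] \subset 'N(N)%g.

(* The function c stands for the sum of the c(eta) eta over eta in Perm(G);
   it belongs to L[N] when its support lies in N. *)
Definition in_group_algebra (N : {set {perm G}}) (c : {ffun {perm G} -> L}) :
    Prop :=
  forall eta, eta \notin N -> c eta = 0.

Definition galg_mul (c d : {ffun {perm G} -> L}) : {ffun {perm G} -> L} :=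
  [ffun zeta : {perm G} => \sum_(eta : {perm G}) c eta * d (zeta * eta^-1)%g].

(* The coefficient of eta in the sum of the g(c(mu)) lam(g) mu lam(g)^-1. *)
Definition galg_act (g : G) (c : {ffun {perm G} -> L}) :
    {ffun {perm G} -> L} :=
  [ffun eta : {perm G} => g (c (eta ^ (lam g)^-1)%g)].

Definition fixed_ring (N : {set {perm G}}) (c : {ffun {perm G} -> L}) : Prop :=
  in_group_algebra N c /\ forall g : G, galg_act g c = c.

Definition hopf_act (c : {ffun {perm G} -> L}) (x : L) : L :=
  \sum_(eta : {perm G}) c eta * (eta^-1%g 1%g : G) x.

Lemma hopf_actM (N : {set {perm G}}) c d x :
  fixed_ring N d -> hopf_act (galg_mul c d) x = hopf_act c (hopf_act d x).
Proof.
case=> _ fixd; rewrite /hopf_act.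
under eq_bigr do rewrite ffunE big_distrl /=.
rewrite exchange_big /=; apply: eq_bigr => eta _.
rewrite rmorph_sum big_distrr /=; set tau := (eta^-1%g 1%g).
rewrite (reindex_inj (mulIg eta)) /= [RHS](reindex_inj (conjg_inj (lam tau)^-1%g)).
apply: eq_bigr => mu _; rewrite mulgK invMg permM -/tau rmorphM /= mulrA.
rewrite -[in LHS](fixd tau) ffunE -!mulrA; congr (_ * (_ * _)).
by rewrite -lamE -conjVg conjgE invgK !permM permKV [lam tau 1%g]permE mul1g.
Qed.

Definition associated_order (N : {set {perm G}}) (B : L -> Prop)
    (c : {ffun {perm G} -> L}) : Prop :=
  fixed_ring N c /\ forall x, B x -> B (hopf_act c x).

Definition ambiguous_ideal (OL B : L -> Prop) : Prop :=
  fractional_ideal OL B /\ forall (g : G) x, B x -> B (g x).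

End HopfGalois.

(* Main.v *)
Require Import Defs.
From mathcomp Require Import all_boot all_order all_fingroup all_algebra all_field.

(** Conjugation by [rho g] commutes with the action of [lam G], hence carries
    L[N]^G onto L[N_g]^G.  For h in L[N]^G with conjugate h', the invariance
    of h under [lam g] gives h' . g(x) = g(h . x).  As g maps the ambiguous
    ideal B onto itself, it carries the associated orders onto each other and
    bases of B over the one to bases of B over the other. *)

Set Implicit Arguments.
Unset Strict Implicit.
Unset Printing Implicit Defensive.

Import GRing.Theory.

Local Open Scope ring_scope.

(** A basis [S] of [B] is carried to its image under [psi]. Coefficients travel by [phi] for
    generation and by [phi'] for independence. Freeness forms sums only in the modules, so
    additivity is asked of [psi], while [phi] has to preserve 0. *)
Lemma free_over_transfer (R R' M M' : zmodType)
    (act : R -> M -> M) (act' : R' -> M' -> M')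
    (phi : R -> R') (phi' : R' -> R)
    (psi : {additive M -> M'}) (psi' : M' -> M)
    (A : R -> Prop) (A' : R' -> Prop) (B : M -> Prop) (B' : M' -> Prop) :
  cancel phi' phi -> phi 0 = 0 -> cancel psi psi' -> cancel psi' psi ->
  (forall a, A a -> A' (phi a)) -> (forall a, A' a -> A (phi' a)) ->
  (forall x, B x -> B' (psi x)) -> (forall x, B' x -> B (psi' x)) ->
  (forall a x, A a -> act' (phi a) (psi x) = psi (act a x)) ->
  free_over act A B -> free_over act' A' B'.
Proof.
move=> phiK phi0 psiK psiK' AA' A'A BB' B'B actE [S [SB genS freeS]].
exists (fun y => S (psi' y)); split=> [y /SB/BB'|x /B'B/genS|s a us sS aA s0].
- by rewrite psiK'.
- case=> s [a [sS aA xE]]; exists (map psi s), (fun y => phi (a (psi' y))).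
  split=> [_ /mapP[y ys ->]|y|]; first by rewrite psiK; apply: sS.
    exact: AA'.
  rewrite -[x]psiK' xE raddf_sum big_map; apply: eq_bigr => y _.
  by rewrite psiK actE.
(* The relation is pulled back to [S]: its coefficient at [psi' y] is [phi' (a y)], and [phi] turns
   the vanishing of the latter into that of [a y]. *)
move=> y ys; rewrite -[a y]phiK -phi0 -{1}(psiK' y); congr phi.
apply: (freeS (map psi' s) (fun z => phi' (a (psi z)))) (map_f psi' ys).
- by rewrite map_inj_uniq //; apply: can_inj psiK'.
- by move=> _ /mapP[z zs ->]; apply: sS.
- by move=> z; apply: A'A.
apply: (can_inj psiK); rewrite raddf0 -[RHS]s0 raddf_sum big_map.
apply: eq_bigr => z _; rewrite -actE; last exact: A'A.
by rewrite phiK !psiK'.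
Qed.

Section ConjugateStructure.

Variables (K : fieldType) (L : splittingFieldType K).

Notation G := (gal_of {:L}).

Implicit Types (g h : G) (c : {ffun {perm G} -> L}) (N : {set {perm G}}).

(** The inverse makes this the [L]-linear map sending each [mu] to [mu ^ s]. *)
Definition galg_conj (s : {perm G}) c : {ffun {perm G} -> L} :=
  [ffun eta : {perm G} => c (eta ^ s^-1)%g].

Lemma galg_conjK s : cancel (galg_conj s^-1%g) (galg_conj s).
Proof.
by move=> c; apply/ffunP=> eta; rewrite !ffunE invgK -conjgM mulVg conjg1.
Qed.

Lemma galg_conj0 s : galg_conj s 0 = 0.
Proof. by apply/ffunP=> eta; rewrite !ffunE. Qed.

Lemma commute_lam_rho g h : commute (lam g) (rho h).
Proof. by apply/permP=> x; rewrite !permM !permE mulgA. Qed.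

Lemma rhoV g : rho g^-1%g = (rho g)^-1%g.
Proof.
apply/eqP; rewrite eq_sym eq_invg_mul; apply/eqP/permP=> x.
by rewrite permM perm1 !permE mulKg.
Qed.

Lemma fixed_ring_conj N g c :
  fixed_ring N c -> fixed_ring (N :^ rho g)%g (galg_conj (rho g) c).
Proof.
case=> supp fixc; split=> [eta|h].
  by rewrite mem_conjg ffunE; apply: supp.
apply/ffunP=> eta; rewrite !ffunE -[in RHS](fixc h) ffunE -!conjgM.
(* The two sides conjugate [eta] by [(lam h)^-1] and [(rho g)^-1] in opposite orders. *)
have /commuteV/commute_sym/commuteV cVV := commute_lam_rho h g.
by rewrite cVV.
Qed.

Lemma gal_invK g : cancel g g^-1%g.
Proof. by move=> x; rewrite -galM ?memvf // mulgV gal_id. Qed.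

Lemma gal_invKV g : cancel g^-1%g g.
Proof. by move=> x; rewrite -galM ?memvf // mulVg gal_id. Qed.

Lemma galg_actE g c eta : galg_act g c = c -> g (c (eta ^ (lam g)^-1)%g) = c eta.
Proof. by move=> {2}<-; rewrite ffunE. Qed.

Lemma hopf_act_conj N g c x :
  fixed_ring N c -> hopf_act (galg_conj (rho g) c) (g x) = g (hopf_act c x).
Proof.
(* The two sums are reindexed differently so that the coefficient at [mu] becomes [c mu] in both, on
   the right by invariance under [lam g]. *)
case=> _ fixc; rewrite /hopf_act rmorph_sum (reindex_inj (conjg_inj (rho g))).
rewrite [RHS](reindex_inj (conjg_inj (lam g)^-1%g)) /=.
apply: eq_bigr => mu _; rewrite rmorphM /= galg_actE // ffunE conjgK.
(* Both [lam g] and [(rho g)^-1] send 1 to [g]. With [h] the value of [mu^-1] at [g], each side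
   reduces to [h x]. *)
congr (_ * _); rewrite -!conjVg !conjgE invgK !permM.
rewrite [lam g 1%g]permE mul1g -rhoV [rho g^-1%g 1%g]permE invgK mulg1.
by rewrite -[RHS]lamE permKV rhoE gal_invK.
Qed.

Lemma associated_order_conj N (B : L -> Prop) g c :
  (forall h x, B x -> B (h x)) -> associated_order N B c ->
  associated_order (N :^ rho g)%g B (galg_conj (rho g) c).
Proof.
move=> GB [fixc cB]; split=> [|x Bx]; first exact: fixed_ring_conj.
by rewrite -[x](gal_invKV g) (hopf_act_conj _ _ fixc); apply/GB/cB/GB.
Qed.

Lemma free_over_conj N (B : L -> Prop) g :
  (forall h x, B x -> B (h x)) ->
  free_over (@hopf_act K L) (associated_order N B) B ->
  free_over (@hopf_act K L) (associated_order (N :^ rho g)%g B) B.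
Proof.
move=> GB; apply: (free_over_transfer (phi := galg_conj (rho g))
  (phi' := galg_conj (rho g)^-1%g) (psi := g) (psi' := g^-1%g)).
- exact: galg_conjK.
- exact: galg_conj0.
- exact: gal_invK.
- exact: gal_invKV.
- by move=> a; apply: associated_order_conj.
(* Since [(rho g)^-1] is [rho g^-1], the inverse map is again a conjugation of the same kind, now
   from [N :^ rho g] back to [N]. *)
- move=> a /(associated_order_conj g^-1%g GB).
  by rewrite rhoV -conjsgM mulgV conjsg1.
- exact: GB.
- exact: GB.
- by move=> a x [fixa _]; apply: hopf_act_conj fixa.
Qed.

End ConjugateStructure.

Theorem theorem5p1 (K : fieldType) (L : splittingFieldType K)
    (hgal : galois 1%AS {:L})
    (OK : K -> Prop) (OL : L -> Prop)
    (hOK : local_or_global_integers OK)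
    (hOL : local_or_global_integers OL)
    (hOKL : forall x : L, OL x <-> integral_closure OK x)
    (N : {group {perm gal_of {:L}}})
    (hreg : regular_on N) (hstab : G_stable N)
    (g : gal_of {:L})
    (B : L -> Prop) (hB : ambiguous_ideal OL B) :
  free_over (@hopf_act K L) (associated_order N B) B <->
  free_over (@hopf_act K L) (associated_order (N :^ rho g)%g B) B.
Proof.
have [_ GB] := hB.
(* The converse is the direct implication for [N :^ rho g] and [g^-1]. *)
split=> [|/(free_over_conj g^-1%g GB)]; first exact: free_over_conj.
by rewrite rhoV -conjsgM mulgV conjsg1.
Qed.
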